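(* Let $(V,P)$ be a mixing Markov chain, with entropy $h(V,P)$ and with $L(V,P)=-\log\lambda$. Then: (1) $0\le L(V,P)\le h(V,P)$; (2) $L(V,P)=0$ if and only if $(V,P)$ is trivial, i.e. $|V|=1$; (3) $L(V,P)=h(V,P)$ if and only if $(V,P)$ is a measure of maximal entropy.
   Context: A Markov chain $(V,P)$ consists of a finite set $V$ and a stochastic transition matrix $P$ indexed by $V$; it is mixing if $P^k>0$ entrywise for some $k\ge1$. Let $\pi$ be its unique stationary distribution. Let $Q$ be the $|V|\times|V|$ matrix with $Q(u,v)=P(u,v)^2$, let $\lambda$ be its Perron eigenvalue (spectral radius), and $L(V,P)=-\log\lambda$ (natural logarithm). The entropy of $(V,P)$ is $h(V,P)=-\sum_{u,v\in V}\pi(u)P(u,v)\log P(u,v)$, with the convention $0\log0=0$. The chain $(V,P)$ is called a measure of maximal entropy if $h(V,P)\ge h(V,P')$ for all $|V|\times|V|$ stochastic matrices $P'$ such that $P(u,v)>0$ whenever $P'(u,v)>0$. Here, if $P'$ has several stationary distributions, the inequality is required for $h(V,P')=-\sum_{u,v}\pi'(u)P'(u,v)\log P'(u,v)$ with every stationary distribution $\pi'$ of $P'$. *)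

(* Defs.v *)
From HB Require Import structures.
From mathcomp Require Import all_boot all_order all_algebra.
From mathcomp Require Import complex.
From mathcomp Require Import all_classical all_reals all_analysis.

Set Implicit Arguments.
Unset Strict Implicit.
Unset Printing Implicit Defensive.

Import Order.TTheory GRing.Theory Num.Theory.

Local Open Scope classical_set_scope.
Local Open Scope ring_scope.

(* The state space of a chain is 'I_n; distributions are row vectors acted on
   from the right by the transition matrix. *)

Definition stochastic (R : realType) (n : nat) (P : 'M[R]_n) : Prop :=
  (forall u v, 0 <= P u v) /\ (forall u, \sum_v P u v = 1).

Definition mixing (R : realType) (n : nat) (P : 'M[R]_n) : Prop :=
  exists2 k : nat, (1 <= k)%N & forall u v, 0 < (P ^+ k) u v.

Definition is_stationary (R : realType) (n : nat) (P : 'M[R]_n)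
    (pi : 'rV[R]_n) : Prop :=
  [/\ forall u, 0 <= pi 0 u, \sum_u pi 0 u = 1 & pi *m P = pi].

(* A choice of a stationary distribution, with junk value 0 if there is none;
   for mixing P it is the unique one. *)
Definition stationary (R : realType) (n : nat) (P : 'M[R]_n) : 'rV[R]_n :=
  xget 0 [set pi | is_stationary P pi].

(* When P u v = 0 the summand vanishes, which is the convention 0 log 0 = 0. *)
Definition entropy_wrt (R : realType) (n : nat) (pi : 'rV[R]_n)
    (P : 'M[R]_n) : R :=
  - \sum_u \sum_v pi 0 u * P u v * ln (P u v).

Definition entropy (R : realType) (n : nat) (P : 'M[R]_n) : R :=
  entropy_wrt (stationary P) P.

Definition sq_mx (R : realType) (n : nat) (P : 'M[R]_n) : 'M[R]_n :=
  \matrix_(u, v) P u v ^+ 2.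

(* Eigenvalues are taken over R[i]; for n > 0 they form a nonempty finite set,
   so that sup is a maximum. *)
Definition spectral_radius (R : realType) (n : nat) (A : 'M[R]_n) : R :=
  sup [set ComplexField.Normc.normc z |
         z in [set z : R[i] | eigenvalue (map_mx (real_complex R) A) z]].

Definition neglog_perron (R : realType) (n : nat) (P : 'M[R]_n) : R :=
  - ln (spectral_radius (sq_mx P)).

Definition max_entropy (R : realType) (n : nat) (P : 'M[R]_n) : Prop :=
  forall P' : 'M[R]_n, stochastic P' ->
    (forall u v, 0 < P' u v -> 0 < P u v) ->
    forall pi' : 'rV[R]_n, is_stationary P' pi' ->
      entropy_wrt pi' P' <= entropy P.

(* Main.v *)
(* For a nonnegative matrix W with positive eigenvector W r = lam r, the chain
   T(u,v) = W(u,v) r(v) / (lam r(u)) is the unique maximizer of the pressure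
   h(P') + sum pi' P' log W over the chains P' supported on W, and the maximum is
   log lam: the difference is a relative entropy, since the contribution of r is
   a coboundary.  For W = Q = P^2 and P' = P the pressure is h(P) - 2 h(P), which
   gives L <= h with equality iff P = T.  For the 0/1 matrix A supporting P the
   pressure is the entropy, so P has maximal entropy iff it is the Parry chain of
   A.  The two conditions on P agree, the eigenvectors being inverse to each other.
   Finally (1 - lam) sum pi r = sum pi P (1 - P) r, which gives lam <= 1; when
   lam = 1 the entries of P, hence of the positive matrix P^k, are natural
   numbers, and the row sums of P^k force |V| = 1. *)
Require Import Defs.
From mathcomp Require Import all_boot all_order all_algebra.
From mathcomp Require Import all_classical all_reals all_analysis.
From mathcomp Require Import complex ring lra.

Set Implicit Arguments.
Unset Strict Implicit.
Unset Printing Implicit Defensive.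

Import Order.TTheory GRing.Theory Num.Theory numFieldNormedType.Exports.

Local Open Scope classical_set_scope.
Local Open Scope ring_scope.

(** * Powers and supports of nonnegative matrices *)

Lemma exp_mx_ge0 (R : realType) (n : nat) (M : 'M[R]_n) (k : nat) :
  (forall i j, 0 <= M i j) -> forall i j, 0 <= (M ^+ k) i j.
Proof.
move=> M0; elim: k => [|k IH] i j; first by rewrite expr0 mxE ler0n.
by rewrite exprS mxE sumr_ge0// => l _; rewrite mulr_ge0.
Qed.

(** A positive entry of a power comes from a path of length [k] in the support, and every such path
    survives when the support grows. *)
Lemma exp_mx_supp (R : realType) (n : nat) (M N : 'M[R]_n) (k : nat) :
  (forall i j, 0 <= M i j) -> (forall i j, 0 <= N i j) ->
  (forall i j, 0 < M i j -> 0 < N i j) ->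
  forall i j, 0 < (M ^+ k) i j -> 0 < (N ^+ k) i j.
Proof.
move=> M0 N0 MN; elim: k => [|k IH] i j; first by rewrite !expr0 !mxE.
rewrite !exprS !mxE lt0r => /andP[/eqP S0 _].
have /existsP[l Hl] : [exists l, M i l * (M ^+ k) l j != 0].
  apply: contrapT => /negP; rewrite negb_exists => /forallP H; apply: S0.
  by apply: big1 => l _; apply/eqP; rewrite -[_ == _]negbK.
have {}Hl : 0 < N i l * (N ^+ k) l j.
  move: Hl; rewrite mulf_eq0 negb_or => /andP[a b].
  by rewrite mulr_gt0 ?MN ?IH// lt0r ?a ?b /= ?exp_mx_ge0.
rewrite (bigD1 l)//= ltr_pwDl// sumr_ge0// => m _.
by rewrite mulr_ge0 ?exp_mx_ge0.
Qed.

Lemma trmx_exp (R : comNzRingType) (n : nat) (M : 'M[R]_n) (k : nat) :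
  (M^T) ^+ k = (M ^+ k)^T.
Proof.
elim: k => [|k IH]; first by rewrite !expr0 trmx1.
by rewrite exprS exprSr IH trmx_mul.
Qed.

Lemma mulmx_pos (R : realType) (n : nat) (d : 'rV[R]_n) (N : 'M[R]_n) :
  (forall i, 0 <= d 0 i) -> d != 0 -> (forall i j, 0 < N i j) ->
  forall j, 0 < (d *m N) 0 j.
Proof.
move=> d0 /rV0Pn[i di] N0 j; rewrite mxE (bigD1 i)//= ltr_pwDl//.
  by rewrite mulr_gt0// lt0r di d0.
by rewrite sumr_ge0// => l _; rewrite mulr_ge0// ltW.
Qed.

(** * Perron eigenvectors and the spectral radius *)

Lemma perron_left (R : realType) (n : nat) (M : 'M[R]_n) (k : nat) :
  (0 < n)%N -> (0 < k)%N ->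
  (forall i j, 0 <= M i j) -> (forall i j, 0 < (M ^+ k) i j) ->
  exists (lam : R) (x : 'rV[R]_n),
    [/\ 0 < lam, forall i, 0 < x 0 i, \sum_i x 0 i = 1 & x *m M = lam *: x].
Proof.
(* Collatz-Wielandt: take the largest [l] such that [x *m M >= l *: x] for some
   [x] in the simplex; if the inequality were strict somewhere, multiplying by
   [M ^+ k] would make it strict everywhere and [l] could be increased. *)
move=> n_gt0 k_gt0 M0 Mk.
(* Summing [x *m M >= l *: x] over the coordinates of a simplex point, all at most 1, gives
   [l <= C]. *)
pose C := \sum_j \sum_i M i j.
pose S := [set p : R * 'rV[R]_n |
  [/\ 0 <= p.1, forall i, 0 <= p.2 0 i, \sum_i p.2 0 i = 1
    & forall i, 0 <= (p.2 *m M) 0 i - p.1 * p.2 0 i]].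
have le1 (v : 'rV[R]_n) : (forall i, 0 <= v 0 i) -> \sum_i v 0 i = 1 ->
    forall i, v 0 i <= 1.
  by move=> v0 v1 i; rewrite -v1 (bigD1 i)//= lerDl sumr_ge0.
have coordC i : continuous (fun p : R * 'rV[R]_n => p.2 0 i).
  move=> p; apply: (@cvg_comp _ _ _ snd (fun v : 'rV[R]_n => v 0 i)).
    exact: cvg_snd.
  exact: coord_continuous.
have S_compact : compact S.
  apply: (@subclosed_compact _ _
    (`[0, C] `*` [set v : 'rV[R]_n | forall i, `[0, 1]%classic (v 0 i)])).
  - have -> : S =
        ([set p : R * 'rV[R]_n | 0 <= p.1] `&`
         \bigcap_i [set p : R * 'rV[R]_n | 0 <= p.2 0 i]) `&`
      ([set p : R * 'rV[R]_n | \sum_i p.2 0 i = 1] `&`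
       \bigcap_i [set p : R * 'rV[R]_n | 0 <= (p.2 *m M) 0 i - p.1 * p.2 0 i]).
      apply/seteqP; split => p /=.
        by case=> a b c d; split; split => // i _; [exact: b|exact: d].
      by case=> -[a b] [c d]; split => // i; [exact: b|exact: d].
    apply: closedI; apply: closedI.
    + apply: (@preimage_closed _ _ fst [set x : R | 0 <= x]).
        by move=> p _; exact: cvg_fst.
      exact: closed_ge.
    + apply: closed_bigI => i _.
      apply: (@preimage_closed _ _ (fun p : R * 'rV[R]_n => p.2 0 i)
                [set x : R | 0 <= x]).
        by move=> p _; exact: coordC.
      exact: closed_ge.
    + apply: (@preimage_closed _ _ (fun p : R * 'rV[R]_n => \sum_i p.2 0 i)
                [set 1 : R]).
        by move=> p _; apply: (cvg_big add_continuous) => i _; exact: coordC.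
      exact: closed_eq.
    + apply: closed_bigI => i _.
      apply: (@preimage_closed _ _
                (fun p : R * 'rV[R]_n => (p.2 *m M) 0 i - p.1 * p.2 0 i)
                [set x : R | 0 <= x]); last exact: closed_ge.
      move=> p _; apply: cvgB.
        under eq_fun do rewrite mxE.
        rewrite mxE; apply: (cvg_big add_continuous) => j _.
        by apply: cvgM; [exact: coordC|exact: cvg_cst].
      by apply: cvgM; [exact: cvg_fst|exact: coordC].
  - apply: compact_setX; first exact: segment_compact.
    apply: (@rV_compact R n (fun=> `[0, 1]%classic)) => i.
    exact: segment_compact.
  - move=> [l v] [/= l0 v0 v1 lv]; split => /=; last first.
      by move=> i; rewrite in_itv/= v0 le1.
    rewrite in_itv/= l0 -[l]mulr1 -v1 mulr_sumr ler_sum// => j _.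
    move: (lv j); rewrite subr_ge0 => /le_trans; apply.
    rewrite mxE ler_sum// => i _.
    by rewrite ler_piMl// le1.
have scaleE (a : R) (v : 'rV[R]_n) i : (a *: v) 0 i = a * v 0 i by rewrite mxE.
have S_neq0 : S !=set0.
  exists (0, const_mx n%:R^-1); split => //= [i||i].
  - by rewrite mxE invr_ge0.
  - rewrite (eq_bigr (fun=> n%:R^-1));last by move=> j _; rewrite mxE.
    by rewrite sumr_const card_ord -[_ *+ _]mulr_natl mulfV// pnatr_eq0 -lt0n.
  - rewrite mul0r subr0 mxE sumr_ge0// => j _.
    by rewrite mxE mulr_ge0// invr_ge0.
have [[l x]] := compact_EVT_max S_neq0 S_compact
  (continuous_subspaceT (fun p => @cvg_fst _ _ (nbhs p.1) (nbhs p.2) _)).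
rewrite inE => -[/= l0 x0 x1 lx] lmax.
have x_neq0 : x != 0.
  apply/negP => /eqP x0E; move: x1; rewrite x0E.
  under eq_bigr do rewrite mxE.
  by rewrite big1// => /eqP; rewrite eq_sym oner_eq0.
have xM : x *m M = l *: x.
  apply/eqP; rewrite -subr_eq0; apply: contrapT => /negP d_neq0.
  set d := _ - _ in d_neq0.
  pose y := x *m M ^+ k.
  have y_gt0 : forall i, 0 < y 0 i by exact: mulmx_pos.
  have yM : y *m M - l *: y = d *m M ^+ k.
    by rewrite mulmxBl -scalemxAl -!mulmxA -[M *m _]exprS exprSr.
  have yd i : 0 < (y *m M) 0 i - l * y 0 i.
    have -> : (y *m M) 0 i - l * y 0 i = (y *m M - l *: y) 0 i by rewrite !mxE.
    by rewrite yM; apply: mulmx_pos => // j; move: (lx j); rewrite !mxE.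
  (* The least of these ratios exceeds [l] and is admissible for [y] once normalized. *)
  pose r i := (y *m M) 0 i / y 0 i.
  case: (@Order.TotalTheory.arg_minP _ _ _ (Ordinal n_gt0) xpredT r)
    => // i0 _ r_min.
  have lr : l < r i0 by rewrite ltr_pdivlMr// -subr_gt0.
  pose s := \sum_i y 0 i.
  have s_gt0 : 0 < s.
    rewrite /s (bigD1 i0)//= ltr_pwDl// sumr_ge0// => j _; exact: ltW.
  suff : (r i0, s^-1 *: y) \in S.
    by move=> /lmax /=; rewrite leNgt lr.
  rewrite inE; split => /=.
  - exact: le_trans l0 (ltW lr).
  - by move=> i; rewrite mxE mulr_ge0 ?invr_ge0 ?ltW.
  - by under eq_bigr do rewrite mxE; rewrite -mulr_sumr mulVf// gt_eqF.
  - move=> i; rewrite -scalemxAl !scaleE mulrCA -mulrBr.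
    by rewrite mulr_ge0 ?invr_ge0 ?(ltW s_gt0)// subr_ge0 -ler_pdivlMr// r_min.
(* Since [M ^+ k] is positive, so is [l ^+ k *: x]; hence neither [l] nor any coordinate of [x]
   vanishes. *)
have xMk : x *m M ^+ k = l ^+ k *: x.
  elim: (k) => [|m IH]; first by rewrite !expr0 mulmx1 scale1r.
  by rewrite !exprS mulmxA xM -scalemxAl IH scalerA.
have lkx i : 0 < l ^+ k * x 0 i.
  by rewrite -scaleE -xMk; exact: mulmx_pos.
exists l, x; split => //.
  rewrite lt0r l0 andbT; apply/eqP => lE.
  by move: (lkx (Ordinal n_gt0)); rewrite lE expr0n gtn_eqF// mul0r ltxx.
move=> i; rewrite lt0r x0 andbT; apply/eqP => xE.
by move: (lkx i); rewrite xE mulr0 ltxx.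
Qed.

Lemma char_poly_trmx (R : comNzRingType) (n : nat) (M : 'M[R]_n) :
  char_poly M^T = char_poly M.
Proof.
rewrite /char_poly -[RHS]det_tr; congr (\det _).
by rewrite /char_poly_mx raddfB /= tr_scalar_mx map_trmx.
Qed.

(** If [v] is a complex left eigenvector for [z], the triangle inequality gives [|z| |v| <= |v| M]
    entrywise; pairing with [r] yields [|z| <= lam]. *)
Lemma spectral_radius_pos_eigen (R : realType) (n : nat) (M : 'M[R]_n)
    (r : 'I_n -> R) (lam : R) :
  (0 < n)%N -> (forall u v, 0 <= M u v) -> (forall u, 0 < r u) -> 0 <= lam ->
  (forall u, \sum_v M u v * r v = lam * r u) ->
  spectral_radius M = lam.
Proof.
move=> n_gt0 M0 r0 lam0 Mr; rewrite /spectral_radius; set S := image _ _.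
have S_ub : ubound S lam.
  move=> _ [z /= /eigenvalueP[v vM v_neq0] <-].
  pose s := \sum_j `|v 0 j| * (r j)%:C%C.
  have rC0 j : 0 < (r j)%:C%C by rewrite (ltcR 0).
  have s_gt0 : 0 < s.
    move/rV0Pn: v_neq0 => [i vi]; rewrite /s (bigD1 i)//= ltr_pwDl//.
      by rewrite mulr_gt0 ?normr_gt0.
    by rewrite sumr_ge0// => j _; rewrite mulr_ge0 ?normr_ge0 ?(ltW (rC0 j)).
  rewrite -lecR -/(`|z|) -(ler_pM2r s_gt0) /s !mulr_sumr.
  have -> : \sum_i lam%:C%C * (`|v 0 i| * (r i)%:C%C) =
      \sum_j (\sum_i `|v 0 i| * (M i j)%:C%C) * (r j)%:C%C.
    under [RHS]eq_bigr do rewrite mulr_suml.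
    rewrite exchange_big/=; apply: eq_bigr => i _.
    under [RHS]eq_bigr do rewrite -mulrA -rmorphM.
    by rewrite -mulr_sumr -rmorph_sum Mr mulrCA -rmorphM.
  apply: ler_sum => j _; rewrite mulrA -normrM ler_wpM2r ?(ltW (rC0 j))//.
  have -> : z * v 0 j = (v *m map_mx (real_complex R) M) 0 j by rewrite vM mxE.
  rewrite mxE (le_trans (ler_norm_sum _ _ _))//; apply: ler_sum => i _.
  by rewrite normrM mxE /= [X in _ * X]ger0_norm// (lecR 0).
have S_lam : S lam.
  exists lam%:C%C => /=; last by rewrite expr0n addr0 sqrtr_sqr ger0_norm.
  (* [eigenvalue] refers to row vectors while [r] is a right eigenvector, hence the detour through
     the transpose. *)
  rewrite eigenvalue_map eigenvalue_root_char -char_poly_trmx.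
  rewrite -eigenvalue_root_char.
  apply/eigenvalueP; exists (\row_j r j).
    apply/rowP => u; rewrite !mxE -Mr; apply: eq_bigr => v _.
    by rewrite !mxE mulrC.
  by apply/rV0Pn; exists (Ordinal n_gt0); rewrite mxE gt_eqF.
apply/eqP; rewrite eq_le; apply/andP; split.
  by apply: ge_sup => //; exists lam.
by apply: ub_le_sup => //; exists lam.
Qed.

(** * Relative entropy and pressure *)

(** For [p > 0] and [t = ln q - ln p] the expression is [p * (expR t - 1 - t)]. The part [q - p]
    makes each single term nonnegative and cancels when summed over a row of two stochastic
    matrices. *)
Lemma gibbs_term (R : realType) (p q : R) :
  0 <= p -> 0 <= q -> (0 < p -> 0 < q) ->
  0 <= q - p - p * (ln q - ln p) ?= iff (p == q).
Proof.
rewrite le_eqVlt => /predU1P[<-|p0] q0 pq.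
  by rewrite mul0r !subr0; split.
have -> : q - p - p * (ln q - ln p) =
    p * (expR (ln q - ln p) - (1 + (ln q - ln p))).
  rewrite expRB !lnK ?posrE ?pq//; field; exact: lt0r_neq0.
split; first by rewrite mulr_ge0 ?(ltW p0)// subr_ge0 expR_ge1Dx.
have [<-|pq_neq] := eqVneq p q.
  by rewrite subrr expR0 addr0 subrr mulr0 eqxx.
apply/negbTE; rewrite eq_sym gt_eqF// mulr_gt0// subr_gt0 expR_gt1Dx//.
rewrite subr_eq0; apply: contra pq_neq => /eqP/ln_inj -> //; rewrite posrE//.
exact: pq.
Qed.

Lemma pressure_gap (R : realType) (n : nat) (W P : 'M[R]_n) (r : 'I_n -> R)
    (lam : R) (pi : 'rV[R]_n) :
  (forall u, 0 < r u) -> 0 < lam ->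
  (forall u, \sum_v W u v * r v = lam * r u) ->
  stochastic P -> is_stationary P pi ->
  (forall u v, 0 < P u v -> 0 < W u v) ->
  \sum_u \sum_v pi 0 u *
    (W u v * r v / (lam * r u) - P u v
     - P u v * (ln (W u v * r v / (lam * r u)) - ln (P u v))) =
  ln lam - entropy_wrt pi P - \sum_u \sum_v pi 0 u * P u v * ln (W u v).
Proof.
move=> r0 lam0 Wr [P0 P1] [pi0 pi1 piP] PW.
have piP_sum : \sum_u \sum_v pi 0 u * P u v = 1.
  by under eq_bigr do rewrite -mulr_sumr P1 mulr1.
have piT_sum : \sum_u \sum_v pi 0 u * (W u v * r v / (lam * r u)) = 1.
  rewrite -pi1; apply: eq_bigr => u _.
  rewrite -mulr_sumr -mulr_suml Wr mulfV ?mulr1//.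
  by rewrite mulf_neq0// lt0r_neq0.
(* Both marginals of the weights [pi 0 u * P u v] equal [pi]. *)
have coboundary : \sum_u \sum_v pi 0 u * P u v * (ln (r v) - ln (r u)) = 0.
  under eq_bigr do under eq_bigr do rewrite mulrBr.
  under eq_bigr do rewrite sumrB.
  rewrite sumrB exchange_big/=; apply/eqP; rewrite subr_eq0; apply/eqP.
  apply: eq_bigr => u _; rewrite -!mulr_suml -mulr_sumr P1 mulr1.
  by congr (_ * _); rewrite -[in RHS]piP mxE.
rewrite /entropy_wrt opprK.
transitivity (\sum_u \sum_v pi 0 u * (W u v * r v / (lam * r u)) -
  \sum_u \sum_v pi 0 u * P u v +
  (ln lam * (\sum_u \sum_v pi 0 u * P u v) -
   \sum_u \sum_v pi 0 u * P u v * (ln (r v) - ln (r u)) +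
   \sum_u \sum_v pi 0 u * P u v * ln (P u v) -
   \sum_u \sum_v pi 0 u * P u v * ln (W u v))); last first.
  by rewrite piT_sum piP_sum coboundary; ring.
rewrite !pair_bigA/= mulr_sumr -!sumrN -!big_split/=.
apply: eq_bigr => -[u v] _ /=.
have := P0 u v; rewrite le_eqVlt => /predU1P[<-|Puv]; first by ring.
have W0 := PW _ _ Puv.
rewrite ln_div ?posrE ?mulr_gt0// !lnM ?posrE//; ring.
Qed.

Section Pressure.
Variables (R : realType) (n : nat) (W P : 'M[R]_n) (r : 'I_n -> R).
Variables (lam : R) (pi : 'rV[R]_n).
Hypotheses (W_ge0 : forall u v, 0 <= W u v) (r_gt0 : forall u, 0 < r u).
Hypotheses (lam_gt0 : 0 < lam).
Hypothesis Wr : forall u, \sum_v W u v * r v = lam * r u.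
Hypotheses (P_stochastic : stochastic P) (pi_stationary : is_stationary P pi).
Hypothesis PW : forall u v, 0 < P u v -> 0 < W u v.

Let T u v := W u v * r v / (lam * r u).

Let gap_term u v : 0 <= T u v - P u v - P u v * (ln (T u v) - ln (P u v))
  ?= iff (P u v == T u v).
Proof.
apply: gibbs_term; first by case: P_stochastic.
  by rewrite divr_ge0// mulr_ge0// ltW.
by move=> Puv; rewrite divr_gt0 ?mulr_gt0 ?PW.
Qed.

Lemma pressure_le :
  entropy_wrt pi P + \sum_u \sum_v pi 0 u * P u v * ln (W u v) <= ln lam.
Proof.
rewrite -subr_ge0 opprD addrA -(pressure_gap r_gt0)//.
apply: sumr_ge0 => u _; apply: sumr_ge0 => v _.
by rewrite mulr_ge0 ?(gap_term u v)//; case: pi_stationary.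
Qed.

(** A vanishing sum of nonnegative terms vanishes termwise, and positivity of [pi] then gives the
    equality case of [gibbs_term] at every pair of states. *)
Lemma pressure_eq : (forall u, 0 < pi 0 u) ->
  entropy_wrt pi P + \sum_u \sum_v pi 0 u * P u v * ln (W u v) = ln lam <->
  forall u v, P u v = W u v * r v / (lam * r u).
Proof.
move=> pi_gt0.
have term_ge0 u v :
    0 <= pi 0 u * (T u v - P u v - P u v * (ln (T u v) - ln (P u v))).
  by rewrite mulr_ge0 ?(gap_term u v)// ltW.
have gap := pressure_gap r_gt0 lam_gt0 Wr P_stochastic pi_stationary PW.
split=> [E u v|PT]; last first.
  apply/esym/eqP; rewrite -subr_eq0 opprD addrA -gap; apply/eqP.
  rewrite big1// => u _; rewrite big1// => v _.
  by rewrite -PT !subrr mulr0 subr0 mulr0.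
move: gap; rewrite -addrA -opprD E subrr => /eqP.
rewrite psumr_eq0; last by move=> a _; apply: sumr_ge0 => b _; exact: term_ge0.
move=> /allP/(_ u (mem_index_enum _))/=.
rewrite psumr_eq0; last by move=> b _; exact: term_ge0.
move=> /allP/(_ v (mem_index_enum _))/=.
rewrite mulf_eq0 gt_eqF//= eq_sym => H.
by have [_] := gap_term u v; rewrite H => /esym/eqP.
Qed.

End Pressure.

(** * Positive eigenvectors attached to a mixing chain *)

Lemma stationary_gt0 (R : realType) (n : nat) (P : 'M[R]_n) (pi : 'rV[R]_n) :
  mixing P -> is_stationary P pi -> forall u, 0 < pi 0 u.
Proof.
move=> [k _ Pk] [pi0 pi1 piP] u.
have <- : pi *m P ^+ k = pi.
  by elim: (k) => [|m IH]; rewrite ?expr0 ?mulmx1// exprS mulmxA piP.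
apply: mulmx_pos => //; apply/negP => /eqP piE; move: pi1; rewrite piE.
by under eq_bigr do rewrite mxE; rewrite big1// => /eqP; rewrite eq_sym oner_eq0.
Qed.

(** The left Perron vector works: summing the coordinates of [x *m P = lam *: x] forces
    [lam = 1]. *)
Lemma stationary_exists (R : realType) (n : nat) (P : 'M[R]_n) :
  (0 < n)%N -> stochastic P -> mixing P -> exists pi, is_stationary P pi.
Proof.
move=> n_gt0 [P0 P1] [k k_gt0 Pk].
have [lam [x [lam0 x0 x1 xP]]] := perron_left n_gt0 k_gt0 P0 Pk.
exists x; split => //; first by move=> u; exact: ltW.
suff lam1 : lam = 1 by rewrite xP lam1 scale1r.
have : \sum_v (x *m P) 0 v = \sum_v (lam *: x) 0 v by rewrite xP.
under eq_bigr do rewrite mxE.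
under [RHS]eq_bigr do rewrite mxE.
rewrite exchange_big/= -mulr_sumr x1 mulr1 => <-.
by under eq_bigr do rewrite -mulr_sumr P1 mulr1.
Qed.

(** Stated through the support of [P] so as to serve both [sq_mx P] and the 0/1 support matrix; it
    is [perron_left] for the transpose. *)
Lemma perron_right (R : realType) (n : nat) (M P : 'M[R]_n) :
  (0 < n)%N -> (forall u v, 0 <= M u v) -> (forall u v, 0 <= P u v) ->
  mixing P -> (forall u v, 0 < P u v -> 0 < M u v) ->
  exists (lam : R) (r : 'I_n -> R),
    [/\ 0 < lam, forall u, 0 < r u & forall u, \sum_v M u v * r v = lam * r u].
Proof.
move=> n_gt0 M0 P0 [k k_gt0 Pk] PM.
have MT0 u v : 0 <= M^T u v by rewrite mxE.
have MTk u v : 0 < (M^T ^+ k) u v.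
  by rewrite trmx_exp mxE; apply: (exp_mx_supp P0 M0 PM).
have [lam [x [lam0 x0 _ xM]]] := perron_left n_gt0 k_gt0 MT0 MTk.
exists lam, (x 0); split => // u.
have := congr1 (fun y : 'rV_n => y 0 u) xM; rewrite !mxE => <-.
by apply: eq_bigr => v _; rewrite mxE mulrC.
Qed.

(** * Perron eigenvalue at most 1, and the case of equality *)

Lemma mixing_bool_trivial (R : realType) (n : nat) (P : 'M[R]_n) :
  (0 < n)%N -> stochastic P -> mixing P ->
  (forall u v, P u v = 0 \/ P u v = 1) -> n = 1%N.
Proof.
move=> n_gt0 [P0 P1] [k _ Pk] P01.
have Pk_sum u : \sum_v (P ^+ k) u v = 1.
  elim: (k) u => [|m IH] u.
    rewrite expr0 (bigD1 u)//= mxE eqxx big1 ?addr0// => v.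
    by rewrite mxE eq_sym => /negbTE ->.
  rewrite exprS; under eq_bigr do rewrite mxE.
  rewrite exchange_big/=; under eq_bigr do rewrite -mulr_sumr IH mulr1.
  exact: P1.
have Pk_nat u v : (P ^+ k) u v \is a Num.nat.
  elim: (k) u v => [|m IH] u v; first by rewrite expr0 mxE natr_nat.
  rewrite exprS mxE; apply: rpred_sum => w _; apply: rpredM => //.
  by case: (P01 u w) => ->; rewrite ?rpred0 ?rpred1.
apply/eqP; rewrite eqn_leq n_gt0 andbT -(ler_nat R).
rewrite -[leRHS](Pk_sum (Ordinal n_gt0)) -[n in n%:R]card_ord -sumr_const.
apply: ler_sum => v _.
move: (Pk_nat (Ordinal n_gt0) v) (Pk (Ordinal n_gt0) v) => /natrP[m ->].
by rewrite ltr0n ler1n.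
Qed.

(** Stationarity evaluates the [P] part and the eigenvector equation the [P ^ 2] part. For entries
    in [0, 1] and positive [r] the left side is a sum of nonnegative terms. *)
Lemma sq_mx_defect (R : realType) (n : nat) (P : 'M[R]_n) (r : 'I_n -> R)
    (lam : R) (pi : 'rV[R]_n) :
  (forall u, \sum_v sq_mx P u v * r v = lam * r u) -> is_stationary P pi ->
  \sum_u \sum_v pi 0 u * (P u v * (1 - P u v)) * r v =
  (1 - lam) * \sum_u pi 0 u * r u.
Proof.
move=> Qr [_ _ piP]; rewrite mulrBl mul1r.
transitivity (\sum_u \sum_v pi 0 u * P u v * r v -
              \sum_u \sum_v pi 0 u * (sq_mx P u v * r v)).
  rewrite !pair_bigA/= -sumrB; apply: eq_bigr => -[u v] _ /=.
  by rewrite mxE; ring.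
congr (_ - _).
  rewrite exchange_big/=; apply: eq_bigr => v _.
  by rewrite -mulr_suml -[in RHS]piP mxE.
rewrite mulr_sumr; apply: eq_bigr => u _.
by rewrite -mulr_sumr Qr mulrCA.
Qed.

(** * Comparison of the Perron eigenvalue with the entropy *)

Theorem theorem1p2 (R : realType) (n : nat) (P : 'M[R]_n)
    (n_gt0 : (0 < n)%N) (P_stochastic : stochastic P) (P_mixing : mixing P) :
  [/\ 0 <= neglog_perron P <= entropy P,
      neglog_perron P = 0 <-> n = 1%N &
      neglog_perron P = entropy P <-> max_entropy P].
Proof.
have [P0 P1] := P_stochastic.
have Q0 u v : 0 <= sq_mx P u v by rewrite mxE exprn_ge0.
have PQ u v : 0 < P u v -> 0 < sq_mx P u v by move=> h; rewrite mxE exprn_gt0.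
have [lam [r [lam0 r0 Qr]]] := perron_right n_gt0 Q0 P0 P_mixing PQ.
rewrite /neglog_perron (spectral_radius_pos_eigen n_gt0 Q0 r0 (ltW lam0) Qr).
have pi_stat : is_stationary P (stationary P).
  exact: xgetPex (stationary_exists n_gt0 P_stochastic P_mixing).
rewrite /entropy; set pi := stationary P in pi_stat *.
have pi_gt0 := stationary_gt0 P_mixing pi_stat.
have P_le1 u v : P u v <= 1 by rewrite -(P1 u) (bigD1 v)//= lerDl sumr_ge0.
have term_ge0 u v : 0 <= pi 0 u * (P u v * (1 - P u v)) * r v.
  rewrite mulr_ge0 ?(ltW (r0 v))// mulr_ge0 ?(ltW (pi_gt0 u))//.
  by rewrite mulr_ge0// subr_ge0.
have defect := sq_mx_defect Qr pi_stat.
have pir_gt0 : 0 < \sum_u pi 0 u * r u.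
  rewrite (bigD1 (Ordinal n_gt0))//= ltr_pwDl ?mulr_gt0// sumr_ge0// => u _.
  by rewrite mulr_ge0 ?ltW.
have lam_le1 : lam <= 1.
  rewrite -subr_ge0 -(pmulr_lge0 _ pir_gt0) -defect.
  by apply: sumr_ge0 => u _; apply: sumr_ge0 => v _.
(* On the support [ln Q = 2 ln P], so the pressure of [P] for [Q] is minus its entropy. *)
have Q_energy : \sum_u \sum_v pi 0 u * P u v * ln (sq_mx P u v) =
    - entropy_wrt pi P *+ 2.
  rewrite /entropy_wrt opprK -sumrMnl; apply: eq_bigr => u _.
  rewrite -sumrMnl; apply: eq_bigr => v _.
  have := P0 u v; rewrite le_eqVlt => /predU1P[<-|Puv].
    by rewrite mulr0 !mul0r mul0rn.
  by rewrite mxE lnXn// -mulrnAr.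
split.
- rewrite oppr_ge0 ln_le0//=.
  have := pressure_le Q0 r0 lam0 Qr P_stochastic pi_stat PQ.
  by rewrite Q_energy; lra.
- split=> [|n1].
    move=> /eqP; rewrite oppr_eq0 ln_eq0// => /eqP lam1.
    apply: (mixing_bool_trivial n_gt0 P_stochastic P_mixing) => u v.
    move/eqP: defect; rewrite lam1 subrr mul0r.
    rewrite psumr_eq0; last by move=> a _; apply: sumr_ge0 => b _.
    move=> /allP/(_ u (mem_index_enum _))/=.
    rewrite psumr_eq0// => /allP/(_ v (mem_index_enum _))/=.
    rewrite !mulf_eq0 (gt_eqF (pi_gt0 u)) (gt_eqF (r0 v)) orbF/= subr_eq0.
    by case/orP => /eqP ->; [left|right].
  suff -> : lam = 1 by rewrite ln1 oppr0.
  have P_eq1 u v : P u v = 1.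
    have I_eq (a b : 'I_n) : a = b.
      by move: (a) (b); rewrite n1 => i j; rewrite !ord1.
    by rewrite -(P1 u) (bigD1 v)//= big1 ?addr0// => w; rewrite (I_eq w v) eqxx.
  apply/eqP; rewrite eq_sym -subr_eq0.
  rewrite -(mulIr_eq0 _ (mulIf (lt0r_neq0 pir_gt0))).
  rewrite -defect big1// => u _; rewrite big1// => v _.
  by rewrite P_eq1 subrr !mulr0 mul0r.
(* If [P] is the equilibrium state of [ln Q], then [1 / r] is a positive
   eigenvector of its support matrix [A]; conversely, if [P] is the Parry chain of
   an eigenvector [s] of [A], then [1 / s] is a positive eigenvector of [Q]. *)
pose A : 'M[R]_n := \matrix_(u, v) (0 < P u v)%R%:R.
have A0 u v : 0 <= A u v by rewrite mxE ler0n.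
have PA u v : 0 < P u v -> 0 < A u v by rewrite mxE => ->; rewrite ltr01.
(* Here [ln 0 = 0] by default, so [ln] vanishes at every entry of [A]. *)
have A_energy (P' : 'M[R]_n) (pi' : 'rV[R]_n) :
    \sum_u \sum_v pi' 0 u * P' u v * ln (A u v) = 0.
  apply: big1 => u _; apply: big1 => v _; rewrite mxE.
  by case: (0 < P u v); rewrite ?ln1 ?ln0 ?mulr0.
split=> [hL P' P'_st P'P pi' pi'_st|P_max].
  have PT : forall u v, P u v = sq_mx P u v * r v / (lam * r u).
    by apply/(pressure_eq Q0 r0 lam0 Qr P_stochastic pi_stat PQ pi_gt0);
      rewrite Q_energy; lra.
  have rV0 u : 0 < (r u)^-1 by rewrite invr_gt0.
  have lamV0 : 0 < lam^-1 by rewrite invr_gt0.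
  (* On the support [PT] reads [1 / r v = P u v / (lam * r u)]; sum over [v]. *)
  have Ar u : \sum_v A u v * (r v)^-1 = lam^-1 * (r u)^-1.
    rewrite -invfM -[RHS]mul1r -(P1 u) mulr_suml; apply: eq_bigr => v _.
    rewrite mxE; case: ltP => Puv; last first.
      by rewrite (le_anti (introT andP (conj Puv (P0 u v)))) !mul0r.
    have := PT u v; rewrite mxE => PTuv.
    have r_neq0 := lt0r_neq0 (r0 u).
    have rv_neq0 := lt0r_neq0 (r0 v).
    have lam_neq0 := lt0r_neq0 lam0.
    have P_neq0 := lt0r_neq0 Puv.
    apply: (mulfI P_neq0); rewrite mul1r {1}PTuv; field.
    by rewrite r_neq0 rv_neq0 lam_neq0.
  have P'A u v : 0 < P' u v -> 0 < A u v by move=> /P'P/PA.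
  have := pressure_le A0 rV0 lamV0 Ar P'_st pi'_st P'A.
  by rewrite A_energy addr0 lnV ?posrE// hL.
have [mu [s [mu0 s0 As]]] := perron_right n_gt0 A0 P0 P_mixing PA.
(* The Parry chain of [A]: a competitor with the same support as [P], whose entropy attains the
   bound [ln mu]. *)
pose T : 'M[R]_n := \matrix_(u, v) (A u v * s v / (mu * s u)).
have T_st : stochastic T.
  split=> u; first by move=> v; rewrite mxE divr_ge0// mulr_ge0// ltW.
  under eq_bigr do rewrite mxE.
  by rewrite -mulr_suml As mulfV// mulf_neq0// lt0r_neq0.
have TA u v : 0 < T u v -> 0 < A u v.
  rewrite mxE => Tuv; rewrite lt0r A0 andbT; apply/eqP => A_eq0.
  by move: Tuv; rewrite A_eq0 !mul0r ltxx.
have AP u v : 0 < A u v -> 0 < P u v.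
  by rewrite mxE; case: (0 < P u v); rewrite ?ltxx.
have PT u v : 0 < P u v -> 0 < T u v.
  by move=> /PA Auv; rewrite mxE divr_gt0 ?mulr_gt0.
have T_mixing : mixing T.
  case: P_mixing => k k0 Pk; exists k => // u v.
  by apply: (exp_mx_supp P0 T_st.1 PT).
have [piT piT_st] := stationary_exists n_gt0 T_st T_mixing.
have hT : entropy_wrt piT T = ln mu.
  rewrite -[LHS]addr0 -(A_energy T piT).
  apply/(pressure_eq A0 s0 mu0 As T_st piT_st TA) => [|u v].
    exact: stationary_gt0 piT_st.
  by rewrite mxE.
have hP : entropy_wrt pi P = ln mu.
  apply/eqP; rewrite eq_le -{2}hT P_max// ?andbT//; last by move=> u v /TA/AP.
  have := pressure_le A0 s0 mu0 As P_stochastic pi_stat PA.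
  by rewrite A_energy addr0.
have PE : forall u v, P u v = A u v * s v / (mu * s u).
  apply/(pressure_eq A0 s0 mu0 As P_stochastic pi_stat PA pi_gt0).
  by rewrite A_energy addr0.
have sV0 u : 0 < (s u)^-1 by rewrite invr_gt0.
have muV0 : 0 <= mu^-1 by rewrite invr_ge0 ltW.
(* On the support [PE] reads [P u v / s v = 1 / (mu * s u)]; multiply by [P u v] and sum over
   [v]. *)
have Qs u : \sum_v sq_mx P u v * (s v)^-1 = mu^-1 * (s u)^-1.
  rewrite -invfM -[RHS]mul1r -(P1 u) mulr_suml; apply: eq_bigr => v _.
  rewrite mxE; have := P0 u v; rewrite le_eqVlt => /predU1P[<-|Puv].
    by rewrite expr0n !mul0r.
  rewrite expr2 -mulrA; congr (_ * _); rewrite PE mxE Puv mulr1n mul1r.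
  by field; rewrite !lt0r_neq0.
(* Both [lam] and [mu^-1] have a positive eigenvector of [Q], so each is its spectral radius. *)
have -> : lam = mu^-1.
  rewrite -(spectral_radius_pos_eigen n_gt0 Q0 r0 (ltW lam0) Qr).
  exact: spectral_radius_pos_eigen Qs.
by rewrite lnV ?posrE// opprK hP.
Qed.
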